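(* In the setting of the context, there is a constant $j_*$ depending only on the geometric data (including the chosen $x_{\{i,k\}}$) such that for every supersymmetric configuration with $j_I\ge j_*$ for all $I=0,\dots,p$, for all $i\in\{1,\dots,p\}$ and every $\beta$-brane, $$t_i^\beta\le\frac{6T_0+3\,T_i\cdot\max(x_{\{i,k\}})\cdot\max(T_l)}{\min(x_{\{i,k\}})},$$ where $\max(x_{\{i,k\}})$ and $\min(x_{\{i,k\}})$ are taken over all pairs of distinct indices in $\{1,\dots,p\}$ and $\max(T_l)$ over $l\in\{1,\dots,p\}$.
   Context: Geometry. $B$ is a smooth projective complex surface, $\pi:X\to B$ is a smooth elliptically fibered Calabi--Yau threefold with a single section $\sigma$, so $\sigma^2=-c_1\sigma$ and $H^{1,1}(X)$ is spanned by $\sigma$ and $\pi^*H^{1,1}(B)$; $c_1,c_2$ are the Chern classes of $B$. Let $D_1,\dots,D_p\in H^2(B,\mathbb{Z})$, $p=h^{1,1}(B)\ge2$, be linearly independent classes generating the Kähler cone of $B$ or a simplicial subcone; their pullbacks to $X$ are denoted by the same symbols, and $D_0=\sigma+\pi^*c_1$. Let $C$ be the intersection form on $H^{1,1}(B)$, $C_{ij}=D_i\cdot D_j$. Write $c_1=\sum_i b_iD_i$, $b=(b_i)$, $\mathcal K_{00i}=\sum_j b_jC_{ij}$, $\mathcal K_{000}=\sum_{i,j} b_ib_jC_{ij}$. The triple intersection form $\mathcal K$ on $X$ is the symmetric trilinear form with $\mathcal K(D_i,D_j,D_k)=0$, $\mathcal K(D_0,D_i,D_j)=C_{ij}$, $\mathcal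 K(D_0,D_0,D_i)=\mathcal K_{00i}$, $\mathcal K(D_0,D_0,D_0)=\mathcal K_{000}$. Put $T_0=\int_B(c_2+11c_1^2)$ and $T_i=12\,\mathcal K_{00i}$. Assume: (1) all $D_i$ are time-like or light-like for $C$ ($C(D_i,D_i)\ge0$) and lie in the same closed light-cone; (2) $b_i\ge 0$ for all $i$; (3) every $\mathcal K_{00i}$ is a positive integer; (4) $C$ has signature $(1,p-1)$. For each pair $\{i,k\}$, $i\ne k$, fix a positive rational number $x_{\{i,k\}}$ such that the matrix $(M_{\{i,k\}})_{jl}=x_{\{i,k\}}C_{ij}C_{kl}+x_{\{i,k\}}C_{il}C_{kj}-C_{jl}$ is positive semi-definite (such numbers exist under (1), (4)). Supersymmetric configuration: a finite collection of D9-brane stacks $\alpha$, each with a positive integer $N^\alpha$ and a flux $F^\alpha=m_0^\alpha D_0+\sum_{i}m_i^\alpha D_i\in H^2(X,\mathbb{Z})$ ($m_I^\alpha\in\mathbb{Q}$, $m_0^\alpha\in\mathbb{Z}$, $\sum_jC_{ij}m_j^\alpha\in\mathbb{Z}$), non-negative integers $n^{D5}_0,\dots,n^{D5}_p$, and a real Kähler class $J=j_0D_0+\sum_ij_iD_i$ with $j_I>0$, such that: $n^{D5}_I-T_I=\sum_\alpha N^\alpha\mathcal K(F^\alpha,F^\alpha,D_I)$ for $I=0,\dots,p$; $\sum_\alpha N^\alpha=16$; and for each $\alpha$, $3\mathcal K(J,J,F^\alpha)=\mathcal K(F^\alpha,F^\alpha,F^\alpha)$ and $\mathcal K(J,J,J)>3\mathcal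 K(J,F^\alpha,F^\alpha)$. A $\beta$-brane is a stack with $m_0^\beta\ne0$; for it, $t_i^\beta=2\sum_jC_{ij}\big(\tfrac{b_j}2+\tfrac{m_j^\beta}{m_0^\beta}\big)$. *)

(* Defs.v *)
(* MathComp world; real numbers are an arbitrary [R : realType]. *)
From mathcomp Require Import all_boot all_order all_algebra.
From mathcomp Require Import reals.
Set Implicit Arguments.
Unset Strict Implicit.
Unset Printing Implicit Defensive.
Import Order.TTheory GRing.Theory Num.Theory.
Local Open Scope ring_scope.

(** * Symmetric bilinear forms *)

Definition bil (F : fieldType) (n : nat) (A : 'M[F]_n) (u v : 'rV[F]_n) : F :=
  \sum_i \sum_j u 0 i * A i j * v 0 j.

Definition psd (F : realFieldType) (n : nat) (A : 'M[F]_n) : Prop :=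
  A^T = A /\ forall v : 'rV[F]_n, 0 <= bil A v v.

Definition has_signature (F : realFieldType) (n : nat) (A : 'M[F]_n)
    (r s : nat) : Prop :=
  exists (P : 'M[F]_n) (d : 'rV[F]_n),
    [/\ P \in unitmx, P^T *m A *m P = diag_mx d,
        #|[set i | 0 < d 0 i]| = r & #|[set i | d 0 i < 0]| = s].

(* For A of signature (1, n - 1) and A(w,w) > 0 this is the one of the two
   closed nappes of {v | A(v,v) >= 0} that contains w. *)
Definition in_light_cone (F : realFieldType) (n : nat) (A : 'M[F]_n)
    (w v : 'rV[F]_n) : Prop :=
  0 <= bil A v v /\ 0 <= bil A w v.

(** * The base surface B and the threefold X

   H^{1,1}(B) has basis D_1, ..., D_p, and H^{1,1}(X) has basis
   D_0 = sigma + pi^* c_1, pi^* D_1, ..., pi^* D_p.  An index 'I_p stands for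
   D_1, ..., D_p; an index 'I_p.+1 for D_0, ..., D_p, where D_0 is [ord0] and
   D_i is [lift ord0 i].  Only the intersection numbers of B and X are
   recorded. *)

Record base_data (p : nat) := BaseData {
  C : 'M[int]_p;       (* C i j = D_i . D_j *)
  b : 'rV[rat]_p;      (* c_1 = \sum_i b_i D_i *)
  c2 : int             (* \int_B c_2 *)
}.

Definition CR (R : realType) (p : nat) (B : base_data p) : 'M[R]_p :=
  map_mx intr (C B).

Definition K00 (p : nat) (B : base_data p) (i : 'I_p) : rat :=
  \sum_j b B 0 j * (C B i j)%:~R.

(* This number is also \int_B c_1^2. *)
Definition K000 (p : nat) (B : base_data p) : rat :=
  \sum_i \sum_j b B 0 i * b B 0 j * (C B i j)%:~R.

Definition T0 (p : nat) (B : base_data p) : rat :=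
  (c2 B)%:~R + 11%:R * K000 B.

Definition T (p : nat) (B : base_data p) (i : 'I_p) : rat :=
  12%:R * K00 B i.

Definition tadpole (p : nat) (B : base_data p) (I : 'I_p.+1) : rat :=
  if unlift ord0 I is Some i then T B i else T0 B.

Definition Kbasis (p : nat) (B : base_data p) (I J L : 'I_p.+1) : rat :=
  match unlift ord0 I, unlift ord0 J, unlift ord0 L with
  | None, None, None => K000 B
  | Some i, None, None | None, Some i, None | None, None, Some i => K00 B i
  | Some i, Some j, None | Some i, None, Some j | None, Some i, Some j =>
      (C B i j)%:~R
  | Some _, Some _, Some _ => 0
  end.

(* The form K extended to H^{1,1}(X) with coefficients in F (rat or R). *)
Definition K (F : fieldType) (p : nat) (B : base_data p)
    (u v w : 'rV[F]_p.+1) : F :=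
  \sum_I \sum_J \sum_L
    ratr (Kbasis B I J L) * u 0 I * v 0 J * w 0 L.

Definition D (F : fieldType) (p : nat) (I : 'I_p.+1) : 'rV[F]_p.+1 :=
  delta_mx 0 I.

(* Numerical constraints satisfied by every smooth projective surface B over
   which there is a smooth elliptic Calabi-Yau threefold with section and for
   which K00 is positive and b nonnegative.  Such a B is rational, so that
   chi(O_B) = 1, b_1(B) = 0 and b_2(B) = h^{1,1}(B) = p.  The last two fields are
   then Noether's formula c_1^2 + c_2 = 12 chi(O_B) and the fact that c_2 is the
   topological Euler number 2 - 2 b_1 + b_2. *)
Record surface_numerics (p : nat) (B : base_data p) : Prop := {
  C_sym : (C B)^T = C B;
  noether : K000 B + (c2 B)%:~R = 12%:R;
  euler_number : c2 B = (p + 2)%N%:Z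
}.

Record geometric_assumptions (R : realType) (p : nat) (B : base_data p)
    : Prop := {
  same_light_cone : exists w : 'rV[R]_p, 0 < bil (CR R B) w w /\
    forall i : 'I_p, in_light_cone (CR R B) w (delta_mx 0 i);
  b_ge0 : forall i, 0 <= b B 0 i;
  K00_pos_int : forall i, K00 B i \is a Num.int /\ 0 < K00 B i;
  C_signature : has_signature (CR R B) 1 (p - 1)
}.

(** * The constants x_{i,k}

   A family indexed by unordered pairs is a function on sets of indices of
   which only the values at [set i; k] with i != k matter. *)

Definition pair_matrix (p : nat) (B : base_data p) (x : {set 'I_p} -> rat)
    (i k : 'I_p) : 'M[rat]_p :=
  \matrix_(j, l) (x [set i; k] * (C B i j)%:~R * (C B k l)%:~R
                  + x [set i; k] * (C B i l)%:~R * (C B k j)%:~R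
                  - (C B j l)%:~R).

Definition pair_constants (R : realType) (p : nat) (B : base_data p)
    (x : {set 'I_p} -> rat) : Prop :=
  forall i k : 'I_p, i != k ->
    0 < x [set i; k] /\
    psd (map_mx ratr (pair_matrix B x i k) : 'M[R]_p).

(* The values are positive, so the unit 0 does not affect a nonempty max. *)
Definition max_x (p : nat) (x : {set 'I_p} -> rat) : rat :=
  \big[Order.max/0]_(i < p) \big[Order.max/0]_(k < p | i != k) x [set i; k].

(* [max_x x] bounds all values, so as unit it does not affect a nonempty min. *)
Definition min_x (p : nat) (x : {set 'I_p} -> rat) : rat :=
  \big[Order.min/max_x x]_(i < p)
    \big[Order.min/max_x x]_(k < p | i != k) x [set i; k].

Definition max_T (p : nat) (B : base_data p) : rat :=
  \big[Order.max/0]_(l < p) T B l.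

(** * Configurations of D9-branes and D5-branes *)

Record config (R : realType) (p : nat) := Config {
  stacks : nat;                               (* number of D9-brane stacks *)
  mult : 'I_stacks -> nat;                    (* N^alpha *)
  flux : 'I_stacks -> 'rV[rat]_p.+1;          (* m^alpha *)
  nD5 : 'I_p.+1 -> nat;
  J : 'rV[R]_p.+1
}.

Definition fluxR (R : realType) (p : nat) (cfg : config R p)
    (a : 'I_(stacks cfg)) : 'rV[R]_p.+1 :=
  map_mx ratr (flux a).

(* m_I for I = 0 is [flux a 0 ord0], and for I = i >= 1 it is
   [flux a 0 (lift ord0 i)]. *)
Definition integral_flux (p : nat) (B : base_data p) (m : 'rV[rat]_p.+1)
    : Prop :=
  m 0 ord0 \is a Num.int /\
  forall i : 'I_p,
    \sum_j (C B i j)%:~R * m 0 (lift ord0 j) \is a Num.int.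

Record supersymmetric (R : realType) (p : nat) (B : base_data p)
    (cfg : config R p) : Prop := {
  mult_gt0 : forall a : 'I_(stacks cfg), (0 < mult a)%N;
  flux_integral : forall a : 'I_(stacks cfg), integral_flux B (flux a);
  J_gt0 : forall I, 0 < J cfg 0 I;
  tadpole_D5 : forall I,
    (nD5 cfg I)%:R - tadpole B I =
    \sum_(a < stacks cfg) (mult a)%:R * K B (flux a) (flux a) (D rat I);
  tadpole_D9 : (\sum_(a < stacks cfg) mult a = 16)%N;
  susy_eq : forall a : 'I_(stacks cfg),
    3%:R * K B (J cfg) (J cfg) (fluxR a) = K B (fluxR a) (fluxR a) (fluxR a);
  susy_ineq : forall a : 'I_(stacks cfg),
    3%:R * K B (J cfg) (fluxR a) (fluxR a) < K B (J cfg) (J cfg) (J cfg)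
}.

Definition is_beta (R : realType) (p : nat) (cfg : config R p)
    (a : 'I_(stacks cfg)) : Prop :=
  flux a 0 ord0 != 0.

Definition t (R : realType) (p : nat) (B : base_data p) (cfg : config R p)
    (a : 'I_(stacks cfg)) (i : 'I_p) : rat :=
  2%:R * \sum_j (C B i j)%:~R *
           (b B 0 j / 2%:R + flux a 0 (lift ord0 j) / flux a 0 ord0).

(* Main.v *)
(** For a stack with [m_0 <> 0] put [u = m / m_0 + c_1 / 2], so that
    [t_l = 2 D_l.u], and [u' = u + c_1 / 2].  In the coordinates centred at
    [D_0 - c_1 / 2] the tadpole charges are [K(F,F,D_l) = m_0^2 t_l] and
    [K(F,F,D_0) = m_0^2 u'^2], and supersymmetry forces [jh.u < 0], where
    [jh = j + j_0 c_1 / 2].  Weighting the tadpoles of the [D_l] by the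
    coefficients of [jh] then bounds [m_0^2 < 16], hence [|m_0| <= 3].

    The constants [x_{i,k}] give [v^2 <= 2 x (D_i.v)(D_k.v)], which already
    contains the Hodge index theorem for classes with nonnegative coefficients.
    So a stack that contributes positively to the [D_0]-tadpole has all
    [D_l.u' < 0], whereas a stack with [t_i > 0] contributes at most
    [- m_0^2 t_i x_{i,k} a_k / 2] for every [k <> i] with
    [a_k = - 2 D_k.u' > 0].
    For large [j_0] all slopes lie close to one hyperplane with positive
    conormal [jh]; comparing a stack with [t_i > 0] to one with [u'^2 > 0], some
    [a_k], [k <> i], is larger for the former, and by integrality larger by
    [1 / |m_0 n_0|] at least, where [n_0] belongs to the latter.  Summing the
    [D_0]-tadpole and using the [D_i]-tadpole bounds [t_i]; the factor 3 is the
    bound on [|n_0|]. *)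
Require Import Defs.
From mathcomp Require Import all_boot all_order all_algebra.
From mathcomp Require Import reals ring lra.
Set Implicit Arguments.
Unset Strict Implicit.
Unset Printing Implicit Defensive.
Import Order.TTheory GRing.Theory Num.Theory.
Local Open Scope ring_scope.

(** * Algebra of bilinear forms *)

Lemma bilE (F : fieldType) n (A : 'M[F]_n) (u v : 'rV[F]_n) :
  bil A u v = (u *m A *m v^T) 0 0.
Proof.
rewrite /bil exchange_big mxE; apply: eq_bigr => j _.
by rewrite !mxE mulr_suml.
Qed.

Lemma bilDl (F : fieldType) n (A : 'M[F]_n) u v w :
  bil A (u + v) w = bil A u w + bil A v w.
Proof. by rewrite !bilE !mulmxDl mxE. Qed.

Lemma bilZl (F : fieldType) n (A : 'M[F]_n) a u v :
  bil A (a *: u) v = a * bil A u v.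
Proof. by rewrite !bilE -!scalemxAl mxE. Qed.

Lemma bilC (F : fieldType) n (A : 'M[F]_n) u v :
  A^T = A -> bil A u v = bil A v u.
Proof.
move=> symA; rewrite !bilE -[in LHS](trmxK (u *m A *m v^T)) [LHS]mxE.
by rewrite !trmx_mul trmxK symA mulmxA.
Qed.

Lemma bilDr (F : fieldType) n (A : 'M[F]_n) u v w :
  bil A u (v + w) = bil A u v + bil A u w.
Proof. by rewrite !bilE linearD mulmxDr mxE. Qed.

Lemma bilZr (F : fieldType) n (A : 'M[F]_n) a u v :
  bil A u (a *: v) = a * bil A u v.
Proof. by rewrite !bilE linearZ -scalemxAr mxE. Qed.

Lemma bil_delta (F : fieldType) n (A : 'M[F]_n) i v :
  bil A (delta_mx 0 i) v = \sum_j A i j * v 0 j.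
Proof.
rewrite bilE -rowE mxE; apply: eq_bigr => j _; by rewrite !mxE.
Qed.

Lemma bil_sum_delta (F : fieldType) n (A : 'M[F]_n) u v :
  bil A u v = \sum_i u 0 i * bil A (delta_mx 0 i) v.
Proof.
apply: eq_bigr => i _; rewrite bil_delta mulr_sumr.
by apply: eq_bigr => j _; rewrite mulrA.
Qed.

(** * The triple intersection form in shifted coordinates *)

Definition base_part (F : fieldType) p (u : 'rV[F]_p.+1) : 'rV[F]_p :=
  \row_i u 0 (lift ord0 i).

Definition c1 (R : realType) p (B : base_data p) : 'rV[R]_p :=
  map_mx ratr (b B).

(** The terms are grouped by the number of indices equal to 0, as in the cases of [Kbasis]. *)
Lemma sum3_ord_recl (V : nmodType) p (f : 'I_p.+1 -> 'I_p.+1 -> 'I_p.+1 -> V) :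
  let s := lift ord0 in
  \sum_I \sum_J \sum_L f I J L = f ord0 ord0 ord0
    + (\sum_i f ord0 ord0 (s i) + \sum_i f ord0 (s i) ord0
       + \sum_i f (s i) ord0 ord0)
    + (\sum_i \sum_j f ord0 (s i) (s j) + \sum_i \sum_j f (s i) ord0 (s j)
       + \sum_i \sum_j f (s i) (s j) ord0)
    + \sum_i \sum_j \sum_l f (s i) (s j) (s l).
Proof.
move=> s; rewrite big_ord_recl big_ord_recl big_ord_recl.
under [X in _ + X + _]eq_bigr => j _ do rewrite big_ord_recl.
under [X in _ + X]eq_bigr => i _ do rewrite big_ord_recl big_ord_recl.
rewrite !big_split /=.
under [X in _ + (_ + X)]eq_bigr => i _ do
  under eq_bigr => j _ do rewrite big_ord_recl.
under [X in _ + (_ + X)]eq_bigr => i _ do rewrite big_split.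
rewrite !big_split /= -!addrA; congr (_ + (_ + (_ + _))).
rewrite addrCA; congr (_ + _); rewrite addrCA; congr (_ + (_ + _)).
Qed.

Section K_expansion.
Variables (R : realType) (p : nat) (B : base_data p).
Hypothesis symC : (C B)^T = C B.
Local Notation G := (CR R B).
Local Notation c := (c1 R B).

Lemma CR_sym : G^T = G.
Proof. by rewrite /CR map_trmx symC. Qed.

Lemma ratr_K00 i : ratr (K00 B i) = bil G (delta_mx 0 i) c.
Proof.
rewrite bil_delta rmorph_sum; apply: eq_bigr => j _.
by rewrite rmorphM /= ratr_int !mxE mulrC.
Qed.

Lemma ratr_K000 : ratr (K000 B) = bil G c c.
Proof.
rewrite rmorph_sum; apply: eq_bigr => i _.
rewrite rmorph_sum; apply: eq_bigr => j _.
by rewrite !rmorphM /= ratr_int !mxE mulrAC.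
Qed.

Lemma KE (u v w : 'rV[R]_p.+1) :
  let u0 := u 0 ord0 in let v0 := v 0 ord0 in let w0 := w 0 ord0 in
  let ub := base_part u in let vb := base_part v in let wb := base_part w in
  K B u v w = u0 * v0 * w0 * bil G c c
    + (u0 * v0 * bil G wb c + u0 * w0 * bil G vb c + v0 * w0 * bil G ub c)
    + (w0 * bil G ub vb + v0 * bil G ub wb + u0 * bil G vb wb).
Proof.
move=> u0 v0 w0 ub vb wb.
have lin (z : 'rV[R]_p.+1) a :
    \sum_i ratr (K00 B i) * a * z 0 (lift ord0 i) = a * bil G (base_part z) c.
  rewrite bil_sum_delta mulr_sumr; apply: eq_bigr => i _.
  by rewrite ratr_K00 !mxE; ring.
have quad (y z : 'rV[R]_p.+1) a :
    \sum_i \sum_j (C B i j)%:~R * a * y 0 (lift ord0 i) * z 0 (lift ord0 j)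
    = a * bil G (base_part y) (base_part z).
  rewrite mulr_sumr; apply: eq_bigr => i _; rewrite mulr_sumr.
  by apply: eq_bigr => j _; rewrite !mxE; ring.
rewrite /K sum3_ord_recl /u0 /v0 /w0.
rewrite -!lin -!quad [X in _ + X = _]big1; last first.
  move=> i _; apply: big1 => j _; apply: big1 => l _.
  by rewrite /Kbasis !liftK rmorph0 !mul0r.
have -> : Kbasis B ord0 ord0 ord0 = K000 B by rewrite /Kbasis unlift_none.
rewrite addr0 ratr_K000; congr (_ + (_ + _ + _) + _); first by ring.
1-3: by apply: eq_bigr => i _; rewrite /Kbasis ?unlift_none ?liftK; ring.
rewrite [RHS]addrC [X in _ = _ + X]addrC addrA; congr (_ + _ + _).
all: apply: eq_bigr => i _; apply: eq_bigr => j _.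
all: by rewrite /Kbasis ?unlift_none ?liftK ratr_int; ring.
Qed.

(* With respect to D_0' = D_0 - c_1 / 2 the mixed numbers K(D_0',D_0',D_i)
   vanish. *)
Definition shifted_part (u : 'rV[R]_p.+1) : 'rV[R]_p :=
  base_part u + (u 0 ord0 / 2) *: c.

(** The self-intersection that survives for D_0' = D_0 - c_1 / 2 is D_0'^3 = c_1^2 / 4, called
    [kappa] below. *)
Lemma K_shifted (u v w : 'rV[R]_p.+1) :
  let u0 := u 0 ord0 in let v0 := v 0 ord0 in let w0 := w 0 ord0 in
  let us := shifted_part u in let vs := shifted_part v in
  let ws := shifted_part w in
  K B u v w = u0 * v0 * w0 * (bil G c c / 4)
    + (w0 * bil G us vs + v0 * bil G us ws + u0 * bil G vs ws).
Proof.
rewrite /= KE /shifted_part !bilDl !bilDr !bilZl !bilZr.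
rewrite !(bilC c _ CR_sym).
by field.
Qed.

Lemma shifted_part_D0 : shifted_part (D R ord0) = 2^-1 *: c.
Proof.
rewrite /shifted_part (_ : base_part _ = 0) ?add0r.
  by rewrite mxE eqxx mul1r.
by apply/rowP => i; rewrite !mxE eq_sym (negPf (neq_lift _ _)) andbF.
Qed.

Lemma shifted_part_D i : shifted_part (D R (lift ord0 i)) = delta_mx 0 i.
Proof.
rewrite /shifted_part mxE (negPf (neq_lift _ _)) andbF mul0r scale0r addr0.
by apply/rowP => j; rewrite !mxE (inj_eq lift_inj).
Qed.
End K_expansion.

Lemma ratr_K (R : realType) p (B : base_data p) (u v w : 'rV[rat]_p.+1) :
  ratr (K B u v w) =
  K B (map_mx ratr u) (map_mx ratr v) (map_mx ratr w : 'rV[R]_p.+1).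
Proof.
rewrite /K rmorph_sum; apply: eq_bigr => I _.
rewrite rmorph_sum; apply: eq_bigr => J _.
rewrite rmorph_sum; apply: eq_bigr => L _.
(* Over [rat] the form [K] also passes its coefficients through [ratr], which is the identity
   there. *)
have ratr_id q : ratr q = q :> rat by rewrite -(fmorph_eq_rat idfun).
by rewrite ratr_id !rmorphM !mxE.
Qed.

(** * Hodge index and positivity on the base *)

Section Geometry.
Variables (R : realType) (p : nat) (G : 'M[R]_p) (c : 'rV[R]_p).
Variable x : 'I_p -> 'I_p -> R.
Local Notation "<< u , v >>" := (bil G u v).

(** The geometry of the base in the form used by the estimates: [dc_ge1] combines positivity and
    integrality of K_00i, and [pair_bound] is the semi-definiteness of M_{i,k} evaluated on v. *)
Record intersection_basis : Prop := {
  dim_ge2 : (2 <= p)%N;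
  G_sym : G^T = G;
  G_diag_ge0 : forall i, 0 <= << 'e_i, 'e_i >>;
  c_ge0 : forall i, 0 <= c 0 i;
  dc_ge1 : forall i, 1 <= << 'e_i, c >>;
  x_gt0 : forall i k, i != k -> 0 < x i k;
  pair_bound : forall i k v, i != k ->
    << v, v >> <= 2 * x i k * << 'e_i, v >> * << 'e_k, v >>
}.
Hypothesis polG : intersection_basis.

Let bC u v : << u, v >> = << v, u >>.
Proof. exact/bilC/(G_sym polG). Qed.

Lemma bilNl u v : << - u, v >> = - << u, v >>.
Proof. by rewrite -scaleN1r bilZl mulN1r. Qed.

Lemma bilNr u v : << u, - v >> = - << u, v >>.
Proof. by rewrite -scaleN1r bilZr mulN1r. Qed.

Lemma exists_other_index (i : 'I_p) : exists k, k != i.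
Proof.
have /card_gt1P [k [l [_ _ neq_kl]]] : (1 < #|'I_p|)%N.
  by rewrite card_ord (dim_ge2 polG).
have [eq_ki | ] := eqVneq k i; last by exists k.
by exists l; rewrite -eq_ki eq_sym.
Qed.

(** Otherwise, for an i with y_i > 0, all products (D_i.v)(D_k.v) would be positive, and so would be
    their y-weighted sum (D_i.v)(y.v). *)
Lemma exists_opposite_signs (y v : 'rV[R]_p) :
  (forall l, 0 <= y 0 l) -> (exists l, 0 < y 0 l) -> << y, v >> = 0 ->
  exists i k, i != k /\ << 'e_i, v >> * << 'e_k, v >> <= 0.
Proof.
move=> y_ge0 [i yi_gt0] yv0.
case: (boolP [exists k, (k != i) && (<< 'e_i, v >> * << 'e_k, v >> <= 0)]).
  by case/existsP => k /andP [neq_ki le0]; exists i, k; rewrite eq_sym.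
rewrite negb_exists => /forallP sameP; exfalso.
have same k : k != i -> 0 < << 'e_i, v >> * << 'e_k, v >>.
  by move=> neq_ki; have := sameP k; rewrite neq_ki /= -ltNge.
have [k neq_ki] := exists_other_index i.
have vi_neq0 : << 'e_i, v >> != 0.
  by apply: contraTneq (same _ neq_ki) => ->; rewrite mul0r ltxx.
have : 0 < << 'e_i, v >> * << y, v >>.
  rewrite (bil_sum_delta _ y) mulr_sumr (bigD1 i) //= ltr_wpDr //.
    apply: sumr_ge0 => l neq_li; rewrite mulrCA mulr_ge0 ?y_ge0 //.
    exact/ltW/same.
  by rewrite mulrCA -expr2 mulr_gt0 // lt_def sqrf_eq0 vi_neq0 sqr_ge0.
by rewrite yv0 mulr0 ltxx.
Qed.

Lemma hodge_index (y v : 'rV[R]_p) :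
  (forall l, 0 <= y 0 l) -> (exists l, 0 < y 0 l) -> << y, v >> = 0 ->
  << v, v >> <= 0.
Proof.
move=> y_ge0 y_gt0 yv0.
have [i [k [neq_ik le0]]] := exists_opposite_signs y_ge0 y_gt0 yv0.
apply: le_trans (pair_bound polG v neq_ik) _.
by rewrite -mulrA mulr_ge0_le0 // mulr_ge0 // ltW // (x_gt0 polG).
Qed.

(** This is [hodge_index] for the projection y^2 u - (y.u) y of u to the orthogonal complement of
    y. *)
Lemma reversed_cauchy_schwarz (y u : 'rV[R]_p) :
  (forall l, 0 <= y 0 l) -> (exists l, 0 < y 0 l) -> 0 < << y, y >> ->
  << u, u >> * << y, y >> <= << y, u >> ^+ 2.
Proof.
move=> y_ge0 y_gt0 yy_gt0.
have := @hodge_index y (<< y, y >> *: u - << y, u >> *: y) y_ge0 y_gt0.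
rewrite !(bilDl, bilDr, bilNl, bilNr, bilZl, bilZr) (bC u y).
rewrite [X in X - _ = 0]mulrC subrr => /(_ erefl) le0.
rewrite -subr_le0 -(pmulr_rle0 _ yy_gt0).
by apply: le_trans le0; rewrite le_eqVlt; apply/orP; left; apply/eqP; ring.
Qed.

Lemma c_gt0 : exists l, 0 < c 0 l.
Proof.
have p_gt0 : (0 < p)%N by apply: ltnW; exact: dim_ge2 polG.
pose i := Ordinal p_gt0; case: (boolP [exists l, 0 < c 0 l]) => [/existsP //|].
rewrite negb_exists => /forallP c_le0; have := dc_ge1 polG i.
rewrite bC bil_sum_delta big1 ?ler10 // => l _.
by have := c_le0 l; rewrite -leNgt le_eqVlt ltNge (c_ge0 polG) orbF => /eqP ->;
   rewrite mul0r.
Qed.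

(** For i != k the vector (D_k.c) D_i - (D_i.c) D_k is orthogonal to c, so its square is at most 0;
    since D_i^2 and D_k^2 are nonnegative, the mixed term must be too. *)
Lemma G_ge0 i k : 0 <= << 'e_i, 'e_k >>.
Proof.
have [<-|neq_ik] := eqVneq i k; first exact: G_diag_ge0.
have ci := lt_le_trans ltr01 (dc_ge1 polG i).
have ck := lt_le_trans ltr01 (dc_ge1 polG k).
have := @hodge_index c (<< 'e_k, c >> *: 'e_i - << 'e_i, c >> *: 'e_k)
  (c_ge0 polG) c_gt0.
rewrite !(bilDl, bilDr, bilNl, bilNr, bilZl, bilZr) !(bC c).
rewrite [X in X - _ = 0]mulrC subrr => /(_ erefl).
rewrite (bC 'e_k 'e_i) => le0.
have cick := mulr_gt0 ci ck; rewrite -(pmulr_rge0 _ cick).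
have := mulr_ge0 (sqr_ge0 << 'e_k, c >>) (G_diag_ge0 polG i).
have := mulr_ge0 (sqr_ge0 << 'e_i, c >>) (G_diag_ge0 polG k).
by lra.
Qed.

Lemma bil_ge0 (u v : 'rV[R]_p) :
  (forall l, 0 <= u 0 l) -> (forall l, 0 <= v 0 l) -> 0 <= << u, v >>.
Proof.
move=> u_ge0 v_ge0; rewrite bil_sum_delta sumr_ge0 // => i _.
rewrite mulr_ge0 // bC bil_sum_delta sumr_ge0 // => k _.
by rewrite mulr_ge0 // G_ge0.
Qed.

(** * Supersymmetric slopes in a background with large Kaehler class *)

Section Background.
Variables (j0 : R) (j : 'rV[R]_p).
Local Notation jh := (j + (j0 / 2) *: c).
Local Notation kappa := (<< c, c >> / 4).

(* [10] keeps the corrections of relative size [1 / j0^2] in [flux_sq_lt16]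
   small, the sum gives [38 j.c <= j^2], and [2 c^2] absorbs the term
   [m^2 kappa] of [slope_eq] when [m^2 < 16]. *)
Definition large_bound : R := 10 + 38 * (\sum_l c 0 l) + 2 * << c, c >>.

Hypothesis j0_large : large_bound <= j0.
Hypothesis j_large : forall l, large_bound <= j 0 l.

Lemma c_le_large l : 38 * c 0 l + 10 <= large_bound.
Proof.
rewrite /large_bound; have := bil_ge0 (c_ge0 polG) (c_ge0 polG).
suff : c 0 l <= \sum_l c 0 l by lra.
by rewrite (bigD1 l) //= lerDl sumr_ge0 // => k _; exact: c_ge0.
Qed.

Lemma cc_gt0 : 0 < << c, c >>.
Proof.
have [l cl_gt0] := c_gt0; rewrite bil_sum_delta (bigD1 l) //= ltr_wpDr //.
  apply: sumr_ge0 => k _; rewrite mulr_ge0 ?(c_ge0 polG) //.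
  exact: le_trans ler01 (dc_ge1 polG k).
by rewrite mulr_gt0 // (lt_le_trans ltr01 (dc_ge1 polG l)).
Qed.

Lemma large_ge10 : 10 + 2 * << c, c >> <= large_bound.
Proof.
suff : 0 <= \sum_l c 0 l by rewrite /large_bound; lra.
by apply: sumr_ge0 => k _; exact: c_ge0.
Qed.

Lemma j0_gt0 : 0 < j0.
Proof. by have := cc_gt0; have := large_ge10; have := j0_large; lra. Qed.

Lemma j_gt0 l : 0 < j 0 l.
Proof. by have := cc_gt0; have := large_ge10; have := j_large l; lra. Qed.

Lemma cc_le_jc : << c, c >> <= << j, c >>.
Proof.
have : 0 <= << j - c, c >>.
  apply: bil_ge0 (c_ge0 polG) => l; rewrite !mxE subr_ge0.
  by have := c_le_large l; have := j_large l; have := c_ge0 polG l; lra.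
by rewrite bilDl bilNl subr_ge0.
Qed.

Lemma jc_le_jj : 38 * << j, c >> <= << j, j >>.
Proof.
have : 0 <= << j, j - 38 *: c >>.
  apply: bil_ge0 => l; first exact/ltW/j_gt0.
  rewrite !mxE subr_ge0.
  by have := c_le_large l; have := j_large l; lra.
by rewrite bilDr bilNr bilZr subr_ge0.
Qed.

Lemma jh_gt0 l : 0 < jh 0 l.
Proof.
by rewrite !mxE ltr_wpDr ?j_gt0 // mulr_ge0 ?(c_ge0 polG) // ltW // divr_gt0 ?j0_gt0.
Qed.

Lemma jh_c : << jh, c >> = << j, c >> + 2 * j0 * kappa.
Proof. by rewrite bilDl bilZl; field. Qed.

Lemma jh_jh : << jh, jh >> = << j, j >> + j0 * << j, c >> + j0 ^+ 2 * kappa.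
Proof. by rewrite !(bilDl, bilDr, bilZl, bilZr) (bC c j); field. Qed.

(* [m] is the coefficient of D_0 in the flux and [u] the shifted slope, so that
   the two fields after [flux_ge1] are the supersymmetry conditions. *)
Record susy_slope (m : R) (u : 'rV[R]_p) : Prop := {
  flux_ge1 : 1 <= m ^+ 2;
  slope_eq : 3 * (j0 ^+ 2 * kappa + << jh, jh >>) + 6 * j0 * << jh, u >> =
    m ^+ 2 * (kappa + 3 * << u, u >>);
  slope_ineq : 3 * m ^+ 2 * (j0 * (kappa + << u, u >>) + 2 * << jh, u >>) <
    j0 * (j0 ^+ 2 * kappa + 3 * << jh, jh >>)
}.

(** Multiplying [slope_ineq] by j0 and eliminating 6 j0 jh.u by [slope_eq], the positive factor m^2
    + j0^2 splits off. What remains is m^2 (kappa + 3 u^2) < j0^2 kappa + 3 jh^2, which [slope_eq]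
    turns into the claim. *)
Lemma slope_neg m u : susy_slope m u -> 3 * << jh, u >> < - j0 * kappa.
Proof.
case=> m_ge1 eqS ltS; have j0p := j0_gt0.
have m2p : 0 < m ^+ 2 + j0 ^+ 2 by rewrite ltr_wpDr ?sqr_ge0 //; lra.
set h := << jh, u >> in eqS ltS *; set q := << u, u >> in eqS ltS.
set g := << jh, jh >> in eqS ltS; set k := kappa in eqS ltS *.
have eq1 : 6 * j0 * h = m ^+ 2 * (k + 3 * q) - 3 * (j0 ^+ 2 * k + g) by lra.
have : (m ^+ 2 + j0 ^+ 2) * (m ^+ 2 * k + 3 * m ^+ 2 * q - j0 ^+ 2 * k - 3 * g) < 0.
  move: ltS; rewrite -subr_lt0 -(pmulr_rlt0 _ j0p).
  have : m ^+ 2 * (6 * j0 * h) =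
    m ^+ 2 * (m ^+ 2 * (k + 3 * q) - 3 * (j0 ^+ 2 * k + g)) by rewrite eq1.
  by lra.
rewrite (pmulr_rlt0 _ m2p) => lt0.
rewrite -subr_lt0 -(pmulr_rlt0 _ j0p).
lra.
Qed.

Lemma jh_pos : (forall l, 0 <= jh 0 l) /\ exists l, 0 < jh 0 l.
Proof.
split=> [l|]; first exact/ltW/jh_gt0.
by have [l _] := c_gt0; exists l; exact: jh_gt0.
Qed.

Lemma jj_gt0 : 0 < << j, j >>.
Proof. by have := cc_gt0; have := cc_le_jc; have := jc_le_jj; lra. Qed.

Lemma jh_c_gt0 : 0 < << jh, c >>.
Proof.
have := mulr_gt0 j0_gt0 cc_gt0; have := cc_gt0; have := cc_le_jc.
by rewrite jh_c; lra.
Qed.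

Lemma jh_c_le : j0 * << jh, c >> <= 2 * << jh, jh >>.
Proof.
rewrite jh_c jh_jh; have := jj_gt0; have := cc_le_jc; have := cc_gt0.
have := j0_gt0 => j0p ccp le jjp.
have : 0 <= j0 * << j, c >> by rewrite mulr_ge0 ?ltW //; lra.
by lra.
Qed.

Lemma jh_jh_gt0 : 0 < << jh, jh >>.
Proof.
have := jh_c_le; have : 0 < j0 * << jh, c >> by rewrite mulr_gt0 ?j0_gt0 ?jh_c_gt0.
by lra.
Qed.

(** Up to a relative error of order 1 / j0^2, [slope_eq] forces -2 jh.u >= jh.c, so the hypothesis
    gives m^2 <= 12 up to that error. *)
Lemma flux_sq_lt16 m u : susy_slope m u ->
  m ^+ 2 * (- 2 * << jh, u >>) <= 12 * << jh, c >> -> m ^+ 2 < 16.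
Proof.
move=> susy; have := slope_neg susy; case: susy => m_ge1 eqS _.
have j0p := j0_gt0; have kp := cc_gt0; have jjp := jj_gt0.
have jg : 10 <= j0 by have := large_ge10; have := j0_large; lra.
have gp := jh_jh_gt0; have Hp := jh_c_gt0; have Hg := jh_c_le.
have rcs := @reversed_cauchy_schwarz jh u jh_pos.1 jh_pos.2 gp.
have gH : << jh, jh >> + j0 ^+ 2 * kappa = j0 * << jh, c >> + << j, j >>.
  by rewrite jh_c jh_jh; field.
set h := << jh, u >> in eqS rcs *; set q := << u, u >> in eqS rcs.
set g := << jh, jh >> in eqS gp Hg rcs gH; set k := kappa in eqS gH *.
set H := << jh, c >> in Hp Hg gH *.
have {kp} kp : 0 < k by rewrite /k divr_gt0.
clearbody h q g k H; move: << j, j >> jjp gH => J2 jjp gH.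
move=> lt_h le_m; pose e := - 2 * h; have he : h = - e / 2 by rewrite /e; field.
move: rcs eqS lt_h le_m; rewrite -/e he; clearbody e; clear h he => rcs eqS lt_e le_m.
set M := m ^+ 2 in m_ge1 eqS le_m *; clearbody M.
have j0k : 0 < j0 * k by exact: mulr_gt0.
have a1 : M * k * j0 <= 18 * H.
  have : 0 <= M * (e - 2 / 3 * (j0 * k)) by rewrite mulr_ge0 //; lra.
  by lra.
(* Reversed Cauchy-Schwarz bounds u^2 jh^2 by e^2 / 4; one factor e is traded for 12 H by the
   hypothesis, and j0 H <= 2 jh^2 removes H. *)
have a2 : M * q * j0 <= 6 * e.
  have ep : 0 < e by lra.
  have : M * (q * g) * 4 <= 12 * H * e.
    have : M * (q * g) <= M * (- e / 2) ^+ 2 by rewrite ler_wpM2l //; lra.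
    have : M * e * e <= 12 * H * e by rewrite ler_wpM2r // ltW.
    by lra.
  move=> a3; rewrite -(ler_pM2r gp).
  have : j0 * (M * (q * g) * 4) <= j0 * (12 * H * e) by rewrite ler_wpM2l // ltW.
  have : (12 * e) * (j0 * H) <= 12 * e * (2 * g) by rewrite ler_wpM2l //; lra.
  by lra.
(* By [gH], [slope_eq] says j0 e = j0 H + j^2 - M kappa / 3 - M u^2; [a1] and [a2] bound the last
   two terms. *)
have a4 : (j0 ^+ 2 + 6) * e >= (j0 ^+ 2 - 6) * H.
  have : j0 * (j0 * e) = j0 * (j0 ^+ 2 * k + g - M * k / 3 - M * q).
    by congr (_ * _); lra.
  have : 0 <= j0 * J2 by rewrite mulr_ge0 // ltW.
  have : j0 * (g + j0 ^+ 2 * k) = j0 * (j0 * H + J2) by rewrite gH.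
  by lra.
(* M >= 16 would give e <= 3 H / 4, but j0^2 >= 100 in [a4] gives e >= 94 H / 106. *)
rewrite ltNge; apply/negP => M16.
have s100 : 100 <= j0 ^+ 2 by nra.
have Me : 0 <= (M - 16) * e by rewrite mulr_ge0 //; lra.
have : 0 <= (j0 ^+ 2 - 100) * H by rewrite mulr_ge0 //; lra.
have : 0 <= (j0 ^+ 2 - 100) * (3 / 4 * H - e).
  by rewrite mulr_ge0 //; lra.
by lra.
Qed.

(** * Signs of the slopes and comparison of two stacks *)

Local Notation u' u := (u + 2^-1 *: c).

(** If all D_l.u' were nonnegative, then - jh.c / 2 <= jh.u < 0, and reversed Cauchy-Schwarz would
    bound u^2 by j.c + kappa. In [slope_eq] the left side would be at least 3 j^2 >= 114 j.c, the
    right side at most 64 j.c. *)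
Lemma not_all_ge0 m u : susy_slope m u -> m ^+ 2 < 16 ->
  exists l, << 'e_l, u' u >> < 0.
Proof.
move=> susy M16; have [m_ge1 eqS _] := susy.
case: (boolP [exists l, << 'e_l, u' u >> < 0]) => [/existsP //|].
rewrite negb_exists => /forallP all_ge0; exfalso.
have : 0 <= << jh, u' u >>.
  rewrite bil_sum_delta sumr_ge0 // => l _.
  by rewrite mulr_ge0 ?jh_pos.1 // leNgt all_ge0.
rewrite bilDr bilZr; have := slope_neg susy.
have j0p := j0_gt0; have kp := cc_gt0.
have jg : 10 <= j0 by have := large_ge10; have := j0_large; lra.
have gp := jh_jh_gt0; have Hp := jh_c_gt0; have Hg := jh_c_le.
have rcs := @reversed_cauchy_schwarz jh u jh_pos.1 jh_pos.2 gp.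
have j0k := mulr_gt0 j0p kp.
move=> h_lt0 h_ge.
have q_le : << u, u >> <= << j, c >> + kappa.
  rewrite -(ler_pM2r gp); apply: le_trans rcs _.
  have : << jh, u >> ^+ 2 <= (<< jh, c >> / 2) ^+ 2.
    by rewrite -sqrrN lerXn2r // ?nnegrE; lra.
  have : j0 * (<< j, c >> + kappa) >= << jh, c >> / 2.
    by rewrite jh_c; have := cc_le_jc; nra.
  set r := << j, c >> + kappa; set H := << jh, c >> in Hp Hg *.
  set g := << jh, jh >> in gp Hg *; set h := << jh, u >>.
  move=> a1 a2; apply: le_trans a2 _.
  have : 0 <= H * (j0 * r - H / 2) by rewrite mulr_ge0 //; lra.
  have rp : 0 <= r by rewrite /r; have := cc_le_jc; lra.
  have : 0 <= r * (2 * g - j0 * H) by rewrite mulr_ge0 //; lra.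
  by lra.
have gH : << jh, jh >> + j0 ^+ 2 * kappa = j0 * << jh, c >> + << j, j >>.
  by rewrite jh_c jh_jh; field.
have le16 : m ^+ 2 * (kappa + 3 * << u, u >>) <=
    16 * (kappa + 3 * (<< j, c >> + kappa)).
  apply: (@le_trans _ _ (m ^+ 2 * (kappa + 3 * (<< j, c >> + kappa)))).
    by rewrite ler_wpM2l ?sqr_ge0 //; lra.
  by rewrite ler_wpM2r ?ltW //; have := cc_le_jc; lra.
have : 0 <= j0 * (<< jh, u >> + 2^-1 * << jh, c >>) by rewrite mulr_ge0 // ltW.
have := cc_le_jc; have := jc_le_jj.
by lra.
Qed.

Lemma u'E l u : << 'e_l, u' u >> = << 'e_l, u >> + << 'e_l, c >> / 2.
Proof. by rewrite bilDr bilZr mulrC. Qed.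

(** By [pair_bound], u'^2 > 0 makes all D_l.u' have the same sign, and one of them is negative. *)
Lemma timelike_all_neg m u : susy_slope m u -> m ^+ 2 < 16 ->
  0 < << u' u, u' u >> -> forall l, << 'e_l, u' u >> < 0.
Proof.
move=> susy M16 uu_gt0 l; have [k k_lt0] := not_all_ge0 susy M16.
have [->//|neq_lk] := eqVneq l k.
have := lt_le_trans uu_gt0 (pair_bound polG _ neq_lk).
have xp : 0 < 2 * x l k by rewrite mulr_gt0 // (x_gt0 polG).
by rewrite -mulrA (pmulr_rgt0 _ xp) nmulr_lgt0.
Qed.

Lemma timelike_sq_ge0 m u : susy_slope m u -> m ^+ 2 < 16 ->
  0 < << u' u, u' u >> -> 0 <= << u, u >>.
Proof.
move=> susy M16 uu_gt0; have neg := timelike_all_neg susy M16 uu_gt0.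
have : << c, u' u >> <= 0.
  rewrite bil_sum_delta sumr_le0 // => l _.
  by rewrite mulr_ge0_le0 ?(c_ge0 polG) // ltW.
move: uu_gt0; rewrite !(bilDl, bilDr, bilZl, bilZr) (bC u c); have := cc_gt0.
by lra.
Qed.

Lemma mixed_sq_le0 m u i : susy_slope m u -> m ^+ 2 < 16 ->
  0 < << 'e_i, u >> -> << u, u >> <= 0.
Proof.
move=> susy M16 ui_gt0; have [k] := not_all_ge0 susy M16.
rewrite u'E => uk_lt0; have ek := dc_ge1 polG k.
have [eq_ik|neq_ik] := eqVneq i k; first by move: ui_gt0; rewrite eq_ik; lra.
apply: le_trans (pair_bound polG u neq_ik) _.
have xp := x_gt0 polG neq_ik.
by rewrite -mulrA mulr_ge0_le0 ?mulr_ge0 ?(ltW xp) // mulr_ge0_le0 //; lra.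
Qed.

(* Both slopes lie on the hypersurface [slope_eq]; up to corrections that are
   negligible for large [j0] this is a hyperplane with conormal [jh]. *)
Lemma mixed_timelike_gap m u n z i :
  susy_slope m u -> m ^+ 2 < 16 -> 0 < << 'e_i, u >> ->
  susy_slope n z -> n ^+ 2 < 16 -> 0 < << u' z, u' z >> ->
  jh 0 i * << 'e_i, u >> <=
    \sum_(k | k != i) jh 0 k * (<< 'e_k, u' z >> - << 'e_k, u' u >>).
Proof.
move=> su M16 ui_gt0 sz N16 zz_gt0.
have uu := mixed_sq_le0 su M16 ui_gt0.
have zz := timelike_sq_ge0 sz N16 zz_gt0.
have zi := timelike_all_neg sz N16 zz_gt0 i.
have [M1 eqU _] := su; have [N1 eqZ _] := sz.
have j0p := j0_gt0; have kp := cc_gt0.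
have [jg j8] : 10 <= j0 /\ 10 + 2 * << c, c >> <= jh 0 i.
  split; first by have := large_ge10; have := j0_large; lra.
  have : 0 <= (j0 / 2) * c 0 i.
    by rewrite mulr_ge0 ?(c_ge0 polG) // divr_ge0 // ltW.
  by rewrite !mxE; have := large_ge10; have := j_large i; lra.
have : << jh, u' z >> - << jh, u' u >> =
    \sum_k jh 0 k * (<< 'e_k, u' z >> - << 'e_k, u' u >>).
  rewrite (bil_sum_delta _ jh (u' z)) (bil_sum_delta _ jh (u' u)) -sumrB.
  by apply: eq_bigr => k _; rewrite mulrBr.
rewrite (bigD1 i) //= [X in X - _]bilDr [X in _ - X]bilDr => eq_h.
have k16 : - (16 * kappa) <= 6 * j0 * (<< jh, z >> - << jh, u >>).
  have : 0 <= n ^+ 2 * (kappa + 3 * << z, z >>) by rewrite mulr_ge0 //; lra.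
  have : m ^+ 2 * (kappa + 3 * << u, u >>) <= m ^+ 2 * kappa.
    by rewrite ler_wpM2l //; lra.
  have : m ^+ 2 * kappa <= 16 * kappa by rewrite ler_wpM2r //; lra.
  by lra.
(* Here j0 >= 10 is used; the remaining error kappa is absorbed below by jh_i (D_i.c) / 2, because
   jh_i >= 2 c^2. *)
have k8 : - kappa <= << jh, z >> - << jh, u >>.
  rewrite leNgt; apply/negP => lt_k.
  have : 6 * j0 * (<< jh, z >> - << jh, u >>) < 6 * j0 * - kappa.
    by rewrite ltr_pM2l //; lra.
  have : 0 <= (j0 - 10) * kappa by rewrite mulr_ge0 //; lra.
  by lra.
have Jp := jh_gt0 i; have ei := dc_ge1 polG i.
have Jz : jh 0 i * << 'e_i, u' z >> <= 0 by rewrite mulr_ge0_le0 // ltW.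
have Je : jh 0 i <= jh 0 i * << 'e_i, c >> by rewrite ler_peMr // ltW.
move: eq_h; rewrite mulrBr [X in - (_ * X)]u'E.
set S := \sum_(k | _) _; clearbody S.
by lra.
Qed.

Lemma exists_ge0_of_wsum (i : 'I_p) (f : 'I_p -> R) :
  0 <= \sum_(k | k != i) jh 0 k * f k -> exists2 k, k != i & 0 <= f k.
Proof.
move=> sum_ge0; have [l neq_li] := exists_other_index i.
case: (boolP [exists k, (k != i) && (0 <= f k)]).
  by case/existsP => k /andP []; exists k.
rewrite negb_exists => /forallP neg; exfalso.
have {}neg k : k != i -> f k < 0.
  by move=> neq; have := neg k; rewrite neq /= -ltNge.
move: sum_ge0; rewrite (bigD1 l) //= leNgt => /negP; apply.
have lt_l : jh 0 l * f l < 0 by rewrite pmulr_rlt0 ?neg ?jh_gt0.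
rewrite -[ltRHS]addr0 ltr_leD //.
apply: sumr_le0 => k /andP [neq_ki _].
by rewrite mulr_ge0_le0 ?jh_pos.1 // ltW ?neg.
Qed.

Lemma exists_gt0_of_wsum (i : 'I_p) (f : 'I_p -> R) :
  0 < \sum_(k | k != i) jh 0 k * f k -> exists2 k, k != i & 0 < f k.
Proof.
move=> sum_gt0; case: (boolP [exists k, (k != i) && (0 < f k)]).
  by case/existsP => k /andP []; exists k.
rewrite negb_exists => /forallP neg; exfalso.
move: sum_gt0; rewrite ltNge => /negP; apply.
apply: sumr_le0 => k neq_ki; rewrite mulr_ge0_le0 ?jh_pos.1 //.
by have := neg k; rewrite neq_ki /= -leNgt.
Qed.

(** The D_k-slopes of z, k != i, are large compared with D_k.c although - jh.z <= 6 jh.c, so D_i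
    must carry most of the weight of jh.c. The gap of [mixed_timelike_gap] is then a fixed
    proportion of the slopes themselves. *)
Lemma mixed_timelike_large_gap m u n z i :
  susy_slope m u -> m ^+ 2 < 16 -> 0 < << 'e_i, u >> ->
  susy_slope n z -> n ^+ 2 < 16 -> 0 < << u' z, u' z >> ->
  n ^+ 2 * (- 2 * << jh, z >>) <= 12 * << jh, c >> ->
  (forall k, k != i -> 6 * << 'e_k, c >> <= - << 'e_k, u' z >>) ->
  exists2 k, k != i &
    - << 'e_k, u' z >> * (1 + << 'e_i, u >> / (66 * << 'e_i, c >>)) <=
    - << 'e_k, u' u >>.
Proof.
move=> su M16 ui_gt0 sz N16 zz_gt0 le_z large.
have gap := mixed_timelike_gap su M16 ui_gt0 sz N16 zz_gt0.
have zi := timelike_all_neg sz N16 zz_gt0 i.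
have ei := dc_ge1 polG i; have Jp := jh_gt0 i.
have le6 : - << jh, z >> <= 6 * << jh, c >>.
  have := slope_neg sz; have [N1 _ _] := sz => lt_z.
  have j0k := mulr_gt0 j0_gt0 cc_gt0.
  have : 0 <= (n ^+ 2 - 1) * - << jh, z >> by rewrite mulr_ge0 //; lra.
  by lra.
pose S := \sum_(k | k != i) jh 0 k * - << 'e_k, u' z >>.
(* The terms -D_k.u' - 11/2 D_k.c have jh-weighted sum at most 0. For k != i each is at least a
   twelfth of -D_k.u', and the term at i is at least -11/2 D_i.c; hence 66 = 12 * 11/2. *)
have leS : S <= 66 * (jh 0 i * << 'e_i, c >>).
  have : \sum_k jh 0 k * (- << 'e_k, u' z >> - 11 / 2 * << 'e_k, c >>) <= 0.
    rewrite (_ : \sum_k _ = - << jh, z >> - 6 * << jh, c >>); first by lra.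
    rewrite (bil_sum_delta _ jh z) (bil_sum_delta _ jh c) mulr_sumr -sumrN -sumrB.
    by apply: eq_bigr => k _; rewrite u'E; field.
  rewrite (bigD1 i) //= => le0.
  have : S / 12 <=
      \sum_(k | k != i) jh 0 k * (- << 'e_k, u' z >> - 11 / 2 * << 'e_k, c >>).
    rewrite mulr_suml ler_sum // => k neq_ki; rewrite -mulrA ler_wpM2l ?jh_pos.1 //.
    by have := large k neq_ki; lra.
  have : 0 <= jh 0 i * - << 'e_i, u' z >> by rewrite mulr_ge0 // ?ltW // oppr_gt0.
  by lra.
pose r := << 'e_i, u >> / (66 * << 'e_i, c >>).
have rp : 0 <= r by rewrite divr_ge0 ?ltW // mulr_gt0 //; lra.
have leSr : S * r <= jh 0 i * << 'e_i, u >>.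
  rewrite (_ : jh 0 i * _ = 66 * (jh 0 i * << 'e_i, c >>) * r).
    by rewrite ler_wpM2r.
  by rewrite /r; field; lra.
have : 0 <= \sum_(k | k != i)
    jh 0 k * (- << 'e_k, u' u >> + << 'e_k, u' z >> * (1 + r)).
  rewrite (_ : \sum_(k | _) _ = \sum_(k | k != i)
    jh 0 k * (<< 'e_k, u' z >> - << 'e_k, u' u >>) - S * r); first by lra.
  by rewrite mulr_suml -sumrB; apply: eq_bigr => k _; ring.
case/exists_ge0_of_wsum => k neq_ki le_k; exists k => //.
by rewrite mulNr -/r; lra.
Qed.
End Background.
End Geometry.

(** * Summation of the tadpole conditions over the stacks *)

Section Landscape.
Variables (R : realType) (p : nat) (G : 'M[R]_p) (c : 'rV[R]_p).
Variable x : 'I_p -> 'I_p -> R.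
Hypothesis polG : intersection_basis G c x.
Variables (j0 : R) (j : 'rV[R]_p).
Hypothesis j0_large : large_bound G c <= j0.
Hypothesis j_large : forall l, large_bound G c <= j 0 l.
Local Notation "<< u , v >>" := (bil G u v).
Local Notation jh := (j + (j0 / 2) *: c).
Local Notation u' u := (u + 2^-1 *: c).

Variables (S : finType) (N m : S -> R) (u : S -> 'rV[R]_p) (Q0 : S -> R).
Variables (T0 xmin xmax Tmax : R).
Hypothesis N_ge1 : forall a, 1 <= N a.
Hypothesis m_int : forall a, m a \is a Num.int.
Hypothesis Q0_alpha : forall a, m a = 0 -> Q0 a <= 0.
Hypothesis Q0_beta : forall a, m a != 0 ->
  Q0 a = m a ^+ 2 * << u' (u a), u' (u a) >>.
Hypothesis susy : forall a, m a != 0 -> susy_slope G c j0 j (m a) (u a).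
Hypothesis slope_int : forall a l, m a != 0 ->
  m a * (2 * << 'e_l, u' (u a) >>) \is a Num.int.
Hypothesis tadpole_i : forall l,
  - (12 * << 'e_l, c >>) <= \sum_a N a * (m a ^+ 2 * (2 * << 'e_l, u a >>)).
Hypothesis tadpole_0 : - T0 <= \sum_a N a * Q0 a.
Hypothesis T0_ge0 : 0 <= T0.
Hypothesis xmin_gt0 : 0 < xmin.
Hypothesis x_bounds : forall i k, i != k -> xmin <= x i k <= xmax.
Hypothesis Tmax_bound : forall l, 12 * << 'e_l, c >> <= Tmax.

Let Jp := jh_gt0 polG j0_large j_large.

Let N_ge0 a : 0 <= N a.
Proof. exact: le_trans ler01 (N_ge1 a). Qed.

(** In the sum of the D_l-tadpoles weighted by jh_l every stack contributes nonpositively by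
    [slope_neg], so the bound on the sum holds for each single stack. *)
Lemma tadpole_one a : m a != 0 ->
  m a ^+ 2 * (- 2 * << jh, u a >>) <= 12 * << jh, c >>.
Proof.
move=> ma; have neg e : m e ^+ 2 * (2 * << jh, u e >>) <= 0.
  have [->|me] := eqVneq (m e) 0; first by rewrite expr0n mul0r.
  rewrite mulr_ge0_le0 ?sqr_ge0 //.
  have := slope_neg polG j0_large (susy me).
  by have := mulr_gt0 (j0_gt0 polG j0_large) (cc_gt0 polG); lra.
have : - (12 * << jh, c >>) <= \sum_e N e * (m e ^+ 2 * (2 * << jh, u e >>)).
  rewrite bil_sum_delta mulr_sumr -sumrN.
  rewrite [leRHS](_ : _ = \sum_l jh 0 l *
     \sum_e N e * (m e ^+ 2 * (2 * << 'e_l, u e >>))).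
    apply: ler_sum => l _; rewrite mulrCA -mulrN.
    by apply: ler_wpM2l; [exact/ltW/Jp | exact: tadpole_i].
  under [RHS]eq_bigr => l _ do rewrite mulr_sumr.
  rewrite exchange_big; apply: eq_bigr => e _; rewrite bil_sum_delta.
  by rewrite !mulr_sumr; apply: eq_bigr => l _; ring.
rewrite (bigD1 a) //=.
have : \sum_(e | e != a) N e * (m e ^+ 2 * (2 * << jh, u e >>)) <= 0.
  by apply: sumr_le0 => e _; rewrite mulr_ge0_le0.
have : 0 <= (N a - 1) * - (m a ^+ 2 * (2 * << jh, u a >>)).
  by rewrite mulr_ge0 ?subr_ge0 // oppr_ge0.
by lra.
Qed.

Lemma m_sq_lt16 a : m a != 0 -> m a ^+ 2 < 16.
Proof.
by move=> ma; exact: (flux_sq_lt16 polG j0_large j_large (susy ma) (tadpole_one ma)).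
Qed.

(** These are the stacks with m_0 != 0 that contribute positively to the D_0-tadpole. *)
Definition timelike a := (m a != 0) && (0 < << u' (u a), u' (u a) >>).

(** With a_k = -2 D_k.u', the level [A] separates stacks: some x_{i,k} a_k is at most A for timelike
    ones, and some is at least A for those with D_i.u > 0. Hence every stack has 2 Q0 <= - A q with
    q its D_i-charge, and b gains a further - g q. Adding the D_0-tadpole to A times the D_i-tadpole
    leaves the bound on g q. *)
Lemma slope_bound_sum b i (A g : R) : 0 <= A -> 0 <= g ->
  m b != 0 -> 0 < << 'e_i, u b >> ->
  (forall a, timelike a ->
     exists2 k, k != i & x i k * (- 2 * << 'e_k, u' (u a) >>) <= A) ->
  (forall a, m a != 0 -> 0 < << 'e_i, u a >> ->
     exists2 k, k != i & A <= x i k * (- 2 * << 'e_k, u' (u a) >>)) ->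
  (exists2 k, k != i & A + g <= x i k * (- 2 * << 'e_k, u' (u b) >>)) ->
  g * m b ^+ 2 * (2 * << 'e_i, u b >>) <= 2 * T0 + A * (12 * << 'e_i, c >>).
Proof.
move=> A_ge0 g_ge0 mb ub_gt0 timeA mixedA mixedB.
have ei := dc_ge1 polG i.
have mixed a (h : R) : 0 <= h -> m a != 0 -> 0 < << 'e_i, u a >> ->
    (exists2 k, k != i & h <= x i k * (- 2 * << 'e_k, u' (u a) >>)) ->
    2 * Q0 a <= - h * (m a ^+ 2 * (2 * << 'e_i, u a >>)).
  move=> h_ge0 ma ui_gt0 [k neq_ki le_h]; rewrite Q0_beta //.
  rewrite mulrCA [leRHS]mulrCA ler_wpM2l ?sqr_ge0 //.
  have neq_ik : i != k by rewrite eq_sym.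
  have := pair_bound polG (u' (u a)) neq_ik; rewrite (u'E _ _ i).
  have : h * << 'e_i, u a >> <= h * (<< 'e_i, u a >> + << 'e_i, c >> / 2).
    by rewrite ler_wpM2l //; lra.
  have : (<< 'e_i, u a >> + << 'e_i, c >> / 2) * h <=
    (<< 'e_i, u a >> + << 'e_i, c >> / 2) * (x i k * (- 2 * << 'e_k, u' (u a) >>)).
    by rewrite ler_wpM2l //; lra.
  by lra.
have stack a : 2 * Q0 a <= - A * (m a ^+ 2 * (2 * << 'e_i, u a >>)).
  have [ma|ma] := eqVneq (m a) 0.
    by rewrite ma expr0n mul0r mulr0; have := Q0_alpha ma; lra.
  have [ui_gt0|ui_le0] := ltP 0 << 'e_i, u a >>.
    exact: mixed (mixedA a ma ui_gt0).
  have [uu_gt0|uu_le0] := ltP 0 << u' (u a), u' (u a) >>; last first.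
    rewrite Q0_beta //; apply: (@le_trans _ _ 0).
      by rewrite mulr_ge0_le0 // mulr_ge0_le0 ?sqr_ge0.
    rewrite mulNr oppr_ge0 mulr_ge0_le0 // mulr_ge0_le0 ?sqr_ge0 //; lra.
  have tm : timelike a by rewrite /timelike ma.
  have [k neq_ki le_A] := timeA a tm; rewrite Q0_beta //.
  rewrite mulrCA [leRHS]mulrCA ler_wpM2l ?sqr_ge0 //.
  have neq_ik : i != k by rewrite eq_sym.
  have := timelike_all_neg polG j0_large j_large (susy ma) (m_sq_lt16 ma) uu_gt0 i.
  have := pair_bound polG (u' (u a)) neq_ik; rewrite (u'E _ _ i) => le_uu neg.
  (* For a timelike stack D_i.u' is negative, so here the upper bound A on x_{i,k} a_k is the useful
     one. *)
  have : - (<< 'e_i, u a >> + << 'e_i, c >> / 2) *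
     (x i k * (- 2 * << 'e_k, u' (u a) >>))
     <= - (<< 'e_i, u a >> + << 'e_i, c >> / 2) * A.
    by rewrite ler_wpM2l //; lra.
  have : 0 <= A * << 'e_i, c >> by rewrite mulr_ge0 //; lra.
  by lra.
have Ag_ge0 : 0 <= A + g by rewrite addr_ge0.
have stackb := mixed b _ Ag_ge0 mb ub_gt0 mixedB.
set q := fun a => m a ^+ 2 * (2 * << 'e_i, u a >>) in stack stackb.
have qb : 0 <= q b by rewrite mulr_ge0 ?sqr_ge0 //; lra.
have : \sum_a N a * (2 * Q0 a) <= - A * (\sum_a N a * q a) - g * (N b * q b).
  rewrite mulr_sumr (bigD1 b) //= [X in _ <= X - _](bigD1 b) //=.
  have : \sum_(a | a != b) N a * (2 * Q0 a) <= \sum_(a | a != b) - A * (N a * q a).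
    by apply: ler_sum => a _; rewrite [leRHS]mulrCA ler_wpM2l //; exact: stack.
  have := ler_wpM2l (N_ge0 b) stackb; rewrite -/(q b).
  by lra.
rewrite (_ : \sum_a N a * (2 * Q0 a) = 2 * \sum_a N a * Q0 a); last first.
  by rewrite mulr_sumr; apply: eq_bigr => a _; rewrite mulrCA.
have := ler_wpM2l A_ge0 (tadpole_i i); rewrite -/q.
have : g * q b <= g * (N b * q b) by rewrite ler_wpM2l // ler_peMl.
have -> : g * m b ^+ 2 * (2 * << 'e_i, u b >>) = g * q b by rewrite /q mulrA.
by move: tadpole_0; lra.
Qed.

Lemma int_norm_le3 (y : R) : y \is a Num.int -> y ^+ 2 < 16 -> `|y| <= 3.
Proof.
move=> /intrP [z ->]; rewrite -intr_norm -rmorphXn /=.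
rewrite (_ : 16 = 16%:~R :> R) // (_ : 3 = 3%:~R :> R) // ltr_int ler_int.
by move=> z2; rewrite -ltzD1 -(@ltr_pXn2r _ 2) ?nnegrE // real_normK ?num_real.
Qed.

(** [slope_bound_sum] is applied with A the maximum over timelike stacks of the minimum of x_{i,k}
    a_k over k != i, or A = 0 if there are none. The gain g comes from integrality, or for very
    large A from a proportional gap. *)
Lemma slope_bound b i : m b != 0 ->
  xmin * (2 * << 'e_i, u b >>) <=
  6 * T0 + 3 * (12 * << 'e_i, c >>) * (xmax * Tmax).
Proof.
move=> mb; have ei := dc_ge1 polG i.
have xp := xmin_gt0; have T0p := T0_ge0.
have [k0 neq_k0i] := exists_other_index polG i.
have xmax_ge : xmin <= xmax.
  have neq_ik : i != k0 by rewrite eq_sym.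
  by have /andP [le1 le2] := x_bounds neq_ik; exact: le_trans le1 le2.
have Tm := Tmax_bound i.
have Y_ge : 12 * (xmin * << 'e_i, c >>) <= xmax * Tmax.
  by rewrite mulrCA; apply: ler_pM (ltW xmin_gt0) _ xmax_ge Tm; lra.
have xe : xmin <= xmin * << 'e_i, c >> by rewrite ler_peMr // ltW.
have eY : xmax * Tmax <= << 'e_i, c >> * (xmax * Tmax).
  by rewrite ler_peMl //; lra.
have [ui_gt0|ui_le0] := ltP 0 << 'e_i, u b >>; last first.
  apply: (@le_trans _ _ 0); first by rewrite (pmulr_rle0 _ xp); lra.
  by lra.
(* [h a k] is the number a_k of stack a. *)
pose h a k := - 2 * << 'e_k, u' (u a) >>.
have h_int a k : m a != 0 -> m a * h a k \is a Num.int.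
  by move=> ma; rewrite /h mulNr mulrN rpredN slope_int.
have x_ge k : k != i -> xmin <= x i k <= xmax.
  by move=> neq_ki; apply: x_bounds; rewrite eq_sym.
have x_ge0 k : k != i -> 0 <= x i k.
  by move=> /x_ge /andP [le1 _]; apply: le_trans le1; exact: ltW.
pose kmin a := [arg min_(k < k0 | k != i) (x i k * h a k)]%O.
pose f a := x i (kmin a) * h a (kmin a).
have kminP a : kmin a != i /\ forall k, k != i -> f a <= x i k * h a k.
  by rewrite /f /kmin; case: arg_minP.
have mb1 := norm_intr_ge1 (m_int b) mb.
case: (pickP timelike) => [z0 tz0|no_time]; last first.
  have pos a : m a != 0 -> 0 < << 'e_i, u a >> -> exists2 k, k != i & 0 < h a k.
    move=> ma ua_gt0.
    have [k uk_lt0] := not_all_ge0 polG j0_large j_large (susy ma) (m_sq_lt16 ma).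
    exists k; last by rewrite /h; lra.
    by apply: contraTneq uk_lt0 => ->; rewrite u'E; lra.
  have [kb neq_kb hb_gt0] := pos b mb ui_gt0.
  (* Some a_k of b is positive and m_b a_k is an integer, so a_k >= 1 / |m_b|. *)
  have := @slope_bound_sum b i 0 (xmin / `|m b|) (lexx 0) _ mb ui_gt0.
  rewrite add0r mul0r addr0 => le_g.
  apply: (@le_trans _ _ (2 * T0)); last by lra.
  apply: (@le_trans _ _ (xmin / `|m b| * m b ^+ 2 * (2 * << 'e_i, u b >>))).
    rewrite ler_wpM2r //; first by lra.
    rewrite -[m b ^+ 2]real_normK ?num_real // expr2 mulrA divfK ?normr_eq0 //.
    by rewrite ler_peMr // ltW.
  apply: le_g.
  - by rewrite divr_ge0 // ltW.
  - by move=> a; rewrite no_time.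
  - move=> a ma /(pos a ma) [k neq_ki hk]; exists k => //.
    by rewrite mulr_ge0 ?x_ge0 // ltW.
  - exists kb => //; have /andP [le1 _] := x_ge kb neq_kb.
    apply: ler_pM => //; [exact: ltW | by rewrite invr_ge0|].
    rewrite -/(h b kb) -[_^-1]mul1r ler_pdivrMr ?normr_gt0 //.
    rewrite -[h b kb]gtr0_norm //.
    rewrite -normrM mulrC norm_intr_ge1 ?h_int // mulf_neq0 //.
    by rewrite gt_eqF.
(* The maximiser z serves both sides: every timelike stack attains its minimum below f z, and a
   stack with D_i.u > 0 exceeds z in some a_k, where x_{i,k} a_k of z is already at least f z. *)
pose z := [arg max_(a > z0 | timelike a) f a]%O.
have [tz z_max] : timelike z /\ forall a, timelike a -> f a <= f z.
  by rewrite /z; case: arg_maxP.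
have /andP [mz zz_gt0] := tz.
have hz k : 0 < h z k.
  have := timelike_all_neg polG j0_large j_large (susy mz) (m_sq_lt16 mz) zz_gt0 k.
  by rewrite /h; lra.
have [kz_neq kz_min] := kminP z.
have f_ge0 : 0 <= f z by rewrite mulr_ge0 ?x_ge0 // ltW.
have gap a : m a != 0 -> 0 < << 'e_i, u a >> ->
    exists2 k, k != i & h z k < h a k.
  move=> ma ua_gt0.
  have := mixed_timelike_gap polG j0_large j_large (susy ma) (m_sq_lt16 ma)
    ua_gt0 (susy mz) (m_sq_lt16 mz) zz_gt0.
  have := mulr_gt0 (Jp i) ua_gt0; move=> lt0 /(lt_le_trans lt0).
  case/(exists_gt0_of_wsum polG j0_large j_large) => k neq_ki lt_k.
  by exists k => //; rewrite /h; lra.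
have bound g := @slope_bound_sum b i (f z) g f_ge0 ^~ mb.
have timeA a : timelike a -> exists2 k, k != i & x i k * h a k <= f z.
  by move=> ta; have [neq _] := kminP a; exists (kmin a) => //; exact: z_max.
have mixedA a : m a != 0 -> 0 < << 'e_i, u a >> ->
    exists2 k, k != i & f z <= x i k * h a k.
  move=> ma ua_gt0; have [k neq_ki lt_k] := gap a ma ua_gt0; exists k => //.
  by apply: le_trans (kz_min k neq_ki) _; rewrite ler_wpM2l ?x_ge0 // ltW.
(* [f_gt] can only happen when [D_i] dominates [jh]; then the slopes [h _ k]
   differ by a fixed proportion instead of by integrality. *)
have [f_le|f_gt] := leP (f z) (xmax * Tmax).
  have mz1 := norm_intr_ge1 (m_int z) mz.
  have mz3 := int_norm_le3 (m_int z) (m_sq_lt16 mz).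
  have mbp : 0 < `|m b| by rewrite normr_gt0.
  have mzp : 0 < `|m z| by rewrite normr_gt0.
  have [k neq_ki lt_k] := gap b mb ui_gt0.
  (* The difference of the a_k of b and z is positive and becomes an integer after multiplication by
     m_b m_z. *)
  have le_g := @bound (xmin / (`|m b| * `|m z|)).
  have {}le_g : xmin / (`|m b| * `|m z|) * m b ^+ 2 * (2 * << 'e_i, u b >>)
      <= 2 * T0 + f z * (12 * << 'e_i, c >>).
    apply: le_g => //; first by rewrite divr_ge0 ?mulr_ge0 // ltW.
    exists k => //; have /andP [le1 _] := x_ge k neq_ki.
    rewrite -/(h b k) -[h b k](subrK (h z k)) mulrDr addrC lerD ?kz_min //.
    apply: ler_pM => //; [exact: ltW | by rewrite invr_ge0 mulr_ge0|].
    rewrite -[_^-1]mul1r ler_pdivrMr ?mulr_gt0 // -[h b k - _]gtr0_norm ?subr_gt0 //.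
    rewrite -!normrM norm_intr_ge1 ?mulf_neq0 // ?subr_eq0 ?gt_eqF //.
    rewrite (_ : _ * _ = m z * (m b * h b k) - m b * (m z * h z k)); last by ring.
    by rewrite rpredB // rpredM // h_int.
  have le_f : f z * (12 * << 'e_i, c >>) <= xmax * Tmax * (12 * << 'e_i, c >>).
    by rewrite ler_wpM2r //; lra.
  (* The factor 3 compensates |m_b| / |m_z| >= 1 / 3. *)
  suff : xmin * (2 * << 'e_i, u b >>) <=
    3 * (xmin / (`|m b| * `|m z|) * m b ^+ 2 * (2 * << 'e_i, u b >>)) by lra.
  rewrite mulrA ler_wpM2r //; first by lra.
  rewrite -[m b ^+ 2]real_normK ?num_real //.
  rewrite (_ : 3 * _ = xmin * (3 * `|m b| / `|m z|)); last by field; lra.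
  rewrite ler_peMr ?(ltW xmin_gt0) // ler_pdivlMr // mul1r; lra.
(* From f z > xmax Tmax every a_k of z with k != i exceeds Tmax >= 12 D_k.c. *)
have large k : k != i -> 6 * << 'e_k, c >> <= - << 'e_k, u' (u z) >>.
  move=> neq_ki; have := kz_min k neq_ki; have /andP [_ le2] := x_ge k neq_ki.
  move=> le_f; have : xmax * Tmax < xmax * h z k.
    by apply: lt_le_trans f_gt (le_trans le_f _); rewrite ler_wpM2r // ltW.
  rewrite ltr_pM2l; first by rewrite /h; have := Tmax_bound k; lra.
  exact: lt_le_trans xmax_ge.
have [k neq_ki le_k] := mixed_timelike_large_gap polG j0_large j_large (susy mb)
  (m_sq_lt16 mb) ui_gt0 (susy mz) (m_sq_lt16 mz) zz_gt0 (tadpole_one mz) large.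
set e := << 'e_i, c >> in ei le_k xe eY Y_ge *.
set t := << 'e_i, u b >> in ui_gt0 le_k *.
have rp : 0 <= t / (66 * e) by rewrite divr_ge0 ?ltW // mulr_gt0 //; lra.
have := @bound (f z * (t / (66 * e))).
rewrite -/e -/t => /(_ _ _ timeA mixedA) le_g.
have {}le_g : f z * (t / (66 * e)) * m b ^+ 2 * (2 * t) <= 2 * T0 + f z * (12 * e).
  apply: le_g => //; first exact: mulr_ge0.
  exists k => //; rewrite -[X in X + _]mulr1 -mulrDr.
  apply: (@le_trans _ _ (x i k * h z k * (1 + t / (66 * e)))).
    by rewrite ler_wpM2r ?kz_min //; lra.
  by rewrite -mulrA ler_wpM2l ?x_ge0 // /h; lra.
have m1 : 1 <= m b ^+ 2.
  by rewrite -[m b ^+ 2]real_normK ?num_real // exprn_ege1.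
move: (f z) (xmax * Tmax) f_ge0 f_gt Y_ge eY le_g => A Y A_ge0 YA Y_ge eY le_g.
have le2 : 2 * A * t ^+ 2 <= 66 * e * (2 * T0 + A * (12 * e)).
  rewrite [leRHS]mulrC -ler_pdivrMr; last by lra.
  have r_ge0 : 0 <= A * (t / (66 * e)) * (2 * t).
    by apply: mulr_ge0; [exact: mulr_ge0 | lra].
  rewrite (_ : _ / _ = A * (t / (66 * e)) * (2 * t) * 1); last by field; lra.
  have := ler_wpM2l r_ge0 m1.
  by move: le_g; lra.
(* Otherwise Y >= 12 xmin e gives 2 t > 432 e^2. Then both terms on the right of [le2] are at most 4
   A t, whereas t > 100 on the left. *)
rewrite leNgt; apply/negP => lt_t.
have xt : 432 * e * e < 2 * t.
  rewrite -(ltr_pM2l xmin_gt0); apply: le_lt_trans lt_t.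
  have : e * (12 * (xmin * e)) <= e * Y by rewrite ler_wpM2l //; lra.
  by lra.
have ee : 1 <= e * e by rewrite -[1]mulr1 ler_pM.
have : e * (6 * T0) <= e * (xmin * (2 * t)).
  rewrite ler_wpM2l //; first by lra.
  have : 0 <= e * Y by rewrite mulr_ge0 //; lra.
  by lra.
have : (2 * t) * (12 * (xmin * e)) <= (2 * t) * A by rewrite ler_wpM2l //; lra.
have : A * (432 * e * e) <= A * (2 * t) by rewrite ler_wpM2l // ltW.
have : 0 < A * t by rewrite mulr_gt0 //; lra.
have : A * t * 100 <= A * t * t.
  by rewrite ler_wpM2l // ?mulr_ge0 //; lra.
by lra.
Qed.

End Landscape.

(** * The extremal constants *)

Lemma le_max_x p (x : {set 'I_p} -> rat) i k : i != k -> x [set i; k] <= max_x x.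
Proof.
move=> neq_ik; rewrite /max_x; apply: (bigmax_sup i) => //.
exact: (bigmax_sup k).
Qed.

Lemma min_x_le p (x : {set 'I_p} -> rat) i k : i != k -> min_x x <= x [set i; k].
Proof.
move=> neq_ik; rewrite /min_x; apply: (bigmin_inf i) => //.
exact: (bigmin_inf k).
Qed.

Lemma min_x_gt0 p (x : {set 'I_p} -> rat) :
  (2 <= p)%N -> (forall i k, i != k -> 0 < x [set i; k]) ->
  0 < min_x x.
Proof.
case: p x => [|[|q]] // y _ y_gt0.
(* [max_x] is the default value of the minimum, so it has to be positive too; p >= 2 provides a
   pair. *)
have max_gt0 : 0 < max_x y.
  have neq : ord0 != ord_max :> 'I_q.+2 by [].
  exact: lt_le_trans (y_gt0 _ _ neq) (le_max_x y neq).
by apply: lt_bigmin => // i _; apply: lt_bigmin => // k; exact: y_gt0.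
Qed.

Lemma le_max_T p (B : base_data p) l : T B l <= max_T B.
Proof. exact: le_bigmax. Qed.

(** * From a configuration to slopes and tadpole inequalities *)

Section Main.
Variables (R : realType) (p : nat) (B : base_data p) (x : {set 'I_p} -> rat).
Hypothesis hp : (2 <= p)%N.
Hypothesis hB : surface_numerics B.
Hypothesis hA : geometric_assumptions R B.
Hypothesis hx : pair_constants R B x.
Local Notation G := (CR R B).
Local Notation c := (c1 R B).

Let symG : G^T = G. Proof. exact/CR_sym/(C_sym hB). Qed.

Lemma bil_pair_matrix i k (v : 'rV[R]_p) :
  bil (map_mx ratr (pair_matrix B x i k)) v v =
  2 * ratr (x [set i; k]) * bil G (delta_mx 0 i) v * bil G (delta_mx 0 k) v
    - bil G v v.
Proof.
pose y : R := ratr (x [set i; k]).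
pose s l (w : 'rV[R]_p) := \sum_j (C B l j)%:~R * w 0 j.
have sE l : bil G (delta_mx 0 l) v = s l v.
  by rewrite bil_delta; apply: eq_bigr => j _; rewrite mxE.
have prodE l l' : s l v * s l' v = \sum_j \sum_j'
    (C B l j)%:~R * v 0 j * ((C B l' j')%:~R * v 0 j').
  by rewrite mulr_suml; apply: eq_bigr => j _; rewrite mulr_sumr.
rewrite !sE -/y.
(* The product is written in both orders to match the two symmetrised terms of the matrix. *)
transitivity (y * (s i v * s k v) + y * (s k v * s i v) - bil G v v); last by ring.
rewrite !prodE !mulr_sumr -big_split -sumrB; apply: eq_bigr => j _.
rewrite !mulr_sumr -big_split -sumrB; apply: eq_bigr => l _.
by rewrite !mxE !rmorphB !rmorphD !rmorphM /= !ratr_int -/y; ring.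
Qed.

Lemma intersection_basis_base : intersection_basis G c (fun i k => ratr (x [set i; k])).
Proof.
split=> //.
- have [w [_ cone]] := same_light_cone hA.
  by move=> i; have [] := cone i.
- by move=> i; rewrite mxE ler0q (b_ge0 hA).
- move=> i; rewrite -(ratr_K00 R); have [K_int K_gt0] := K00_pos_int hA i.
  rewrite -(rmorph1 (@ratr R)) ler_rat -(gtr0_norm K_gt0).
  by rewrite norm_intr_ge1 // gt_eqF.
- by move=> i k /hx [x_gt0 _]; rewrite ltr0q.
- move=> i k v /hx [_ [_ /(_ v)]]; rewrite bil_pair_matrix subr_ge0.
  by [].
Qed.

(** c_2 = p + 2 is positive, and c_1^2 is the sum of the b_i K_00i. *)
Lemma T0_ge0 : 0 <= T0 B.
Proof.
rewrite /T0 (euler_number hB) addr_ge0 // mulr_ge0 //.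
rewrite /K000 sumr_ge0 // => i _.
rewrite (_ : \sum_j _ = b B 0 i * K00 B i); last first.
  by rewrite mulr_sumr; apply: eq_bigr => j _; rewrite mulrA.
by rewrite mulr_ge0 ?(b_ge0 hA) // ltW //; have [] := K00_pos_int hA i.
Qed.

Variable cfg : config R p.
Hypothesis susy : supersymmetric B cfg.
Let polG := intersection_basis_base.
Local Notation j0 := (J cfg 0 ord0).
Local Notation j := (base_part (J cfg)).
Hypothesis large : forall I, large_bound G c <= J cfg 0 I.

Let j0_large : large_bound G c <= j0. Proof. exact: large. Qed.
Let j_large l : large_bound G c <= j 0 l. Proof. by rewrite mxE. Qed.

Local Notation F := (@fluxR R p cfg).
Local Notation m a := (F a 0 ord0).

Definition slope (a : 'I_(stacks cfg)) : 'rV[R]_p :=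
  (m a)^-1 *: shifted_part B (F a).

Lemma shifted_part_slope a : m a != 0 -> shifted_part B (F a) = m a *: slope a.
Proof. by move=> ma; rewrite scalerA divff // scale1r. Qed.

Lemma flux0_int a : m a \is a Num.int.
Proof.
have [/intrP [z zE] _] := flux_integral susy a.
by rewrite mxE zE ratr_int intr_int.
Qed.

Lemma slope_susy a : m a != 0 -> susy_slope G c j0 j (m a) (slope a).
Proof.
move=> ma; split.
- rewrite -[m a ^+ 2]real_normK ?num_real // exprn_ege1 //.
  exact: norm_intr_ge1 (flux0_int a) ma.
- have := susy_eq susy a; rewrite !(K_shifted (C_sym hB)).
  rewrite (shifted_part_slope ma) !(bilZl, bilZr) => eqS.
  apply: (mulfI ma); move: eqS.
  by move: (bil _ _ _) (bil _ _ _) (bil _ _ _) (bil _ _ _) => *; lra.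
- have := susy_ineq susy a; rewrite !(K_shifted (C_sym hB)).
  rewrite (shifted_part_slope ma) !(bilZl, bilZr).
  by lra.
Qed.

Lemma K_flux_D a l :
  K B (F a) (F a) (D R (lift ord0 l)) =
  m a ^+ 2 * (2 * bil G (delta_mx 0 l) (slope a)).
Proof.
rewrite (K_shifted (C_sym hB)) shifted_part_D.
rewrite [D _ _ _ _]mxE (negPf (neq_lift _ _)) andbF mulr0n.
(* For m_0 = 0 both sides vanish, since no argument has a D_0-component. *)
have [->|ma] := eqVneq (m a) 0; first by rewrite expr0n /=; ring.
rewrite (shifted_part_slope ma); move: (slope a) => u.
by rewrite !(bilZl, bilZr) (bilC u _ symG); ring.
Qed.

Lemma K_flux_D0 a : m a != 0 ->
  K B (F a) (F a) (D R ord0) =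
  m a ^+ 2 * bil G (slope a + 2^-1 *: c) (slope a + 2^-1 *: c).
Proof.
move=> ma; rewrite (K_shifted (C_sym hB)) shifted_part_D0.
rewrite [D _ _ _ _]mxE !eqxx mulr1n.
rewrite (shifted_part_slope ma); move: (slope a) => u.
by rewrite !(bilDl, bilDr, bilZl, bilZr) (bilC c u symG); field.
Qed.

(** For m_0 = 0 the supersymmetry equation reduces to jh.F = 0, and the charge is F^2 on the base,
    so the Hodge index theorem applies. *)
Lemma K_flux_D0_alpha a : m a = 0 -> K B (F a) (F a) (D R ord0) <= 0.
Proof.
move=> ma; rewrite (K_shifted (C_sym hB)) [D _ _ _ _]mxE !eqxx mulr1n ma.
rewrite !mul0r !mul1r add0r !addr0.
have [jh_ge0 jh_gt0] := jh_pos polG j0_large j_large.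
apply: (hodge_index polG jh_ge0 jh_gt0).
have := susy_eq susy a; rewrite !(K_shifted (C_sym hB)) ma => eq0.
apply: (mulfI (lt0r_neq0 (j0_gt0 polG j0_large))); rewrite mulr0.
by lra.
Qed.

(** m_0 u' is the base part of the flux plus m_0 c_1, so its product with D_l is integral by flux
    quantisation and integrality of K_00l. *)
Lemma slope_integral a l : m a != 0 ->
  m a * (2 * bil G (delta_mx 0 l) (slope a + 2^-1 *: c)) \is a Num.int.
Proof.
move=> ma; rewrite mulrCA -bilZr scalerDr -(shifted_part_slope ma).
rewrite (_ : _ + _ = base_part (F a) + m a *: c); last first.
  by rewrite /shifted_part -addrA scalerA -scalerDl; congr (_ + _ *: _); field.
rewrite bilDr bilZr -(ratr_K00 R).
have [/intrP [z ->] _] := K00_pos_int hA l.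
have [_ /(_ l) /intrP [y yE]] := flux_integral susy a.
have -> : bil G (delta_mx 0 l) (base_part (F a)) = y%:~R.
  rewrite -(ratr_int R) -yE bil_delta rmorph_sum; apply: eq_bigr => k _.
  by rewrite rmorphM /= ratr_int !mxE.
rewrite ratr_int; apply: rpredM; first exact: natr_int.
by rewrite rpredD ?intr_int // rpredM ?flux0_int ?intr_int.
Qed.

Lemma tadpole_bound I :
  - ratr (tadpole B I) <=
  \sum_a (mult a)%:R * K B (F a) (F a) (D R I).
Proof.
have := congr1 (@ratr R) (tadpole_D5 susy I).
rewrite rmorphB /= ratr_nat rmorph_sum => eqI.
rewrite (_ : \sum_a _ = (nD5 cfg I)%:R - ratr (tadpole B I)).
  by rewrite lerDr.
rewrite eqI; apply: eq_bigr => a _.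
rewrite rmorphM /= ratr_nat ratr_K; congr (_ * K _ _ _ _).
by rewrite map_delta_mx.
Qed.

Lemma t_bound (a : 'I_(stacks cfg)) i : is_beta a ->
  t B a i <= (6%:R * T0 B + 3%:R * T B i * max_x x * max_T B) / min_x x.
Proof.
move=> beta_a; have ma : m a != 0 by rewrite mxE fmorph_eq0.
have xmin_gt0 : 0 < min_x x by apply: min_x_gt0 => // i' k /hx [].
rewrite ler_pdivlMr // mulrC -(ler_rat R).
have TE l : ratr (T B l) = 12 * bil G (delta_mx 0 l) c.
  by rewrite rmorphM /= ratr_nat ratr_K00.
rewrite (_ : ratr (min_x x * _) =
  ratr (min_x x) * (2 * bil G (delta_mx 0 i) (slope a))); last first.
  rewrite !rmorphM /= ratr_nat; congr (_ * (_ * _)).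
  rewrite bil_delta rmorph_sum; apply: eq_bigr => k _.
  rewrite rmorphM rmorphD !rmorphM !fmorphV /= ratr_int ratr_nat !mxE.
  congr (_ * _); field; move: ma; rewrite mxE => ->; done.
rewrite (_ : ratr (_ + _) = 6 * ratr (T0 B) +
    3 * (12 * bil G (delta_mx 0 i) c) * (ratr (max_x x) * ratr (max_T B))); last first.
  by rewrite -TE rmorphD !rmorphM /= !ratr_nat; ring.
apply: (@slope_bound R p G c _ polG j0 j j0_large j_large
  'I_(stacks cfg) (fun a => (mult a)%:R) (fun a => m a) slope
  (fun a => K B (F a) (F a) (D R ord0))) => //.
- by move=> e; rewrite ler1n (mult_gt0 susy).
- exact: flux0_int.
- exact: K_flux_D0_alpha.
- exact: K_flux_D0.
- exact: slope_susy.
- by move=> e l; exact: slope_integral.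
- move=> l; have := tadpole_bound (lift ord0 l).
  rewrite /tadpole liftK TE => /le_trans; apply.
  by apply: ler_sum => e _; rewrite K_flux_D.
- by have := tadpole_bound ord0; rewrite /tadpole unlift_none.
- by rewrite ler0q T0_ge0.
- by rewrite ltr0q.
- by move=> k l neq_kl; rewrite !ler_rat min_x_le ?le_max_x.
- by move=> l; rewrite -TE ler_rat le_max_T.
Qed.
End Main.

Theorem theorem2 (R : realType) (p : nat) (hp : (2 <= p)%N)
    (B : base_data p) (hB : surface_numerics B)
    (hA : geometric_assumptions R B)
    (x : {set 'I_p} -> rat) (hx : pair_constants R B x) :
  exists jstar : R,
    forall cfg : config R p,
      supersymmetric B cfg ->
      (forall I : 'I_p.+1, jstar <= J cfg 0 I) ->
      forall (i : 'I_p) (beta : 'I_(stacks cfg)),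
        is_beta beta ->
        t B beta i <=
          (6%:R * T0 B + 3%:R * T B i * max_x x * max_T B) / min_x x.
Proof.
exists (large_bound (CR R B) (c1 R B)) => cfg susy large i beta is_b.
exact: (t_bound hp hB hA hx susy large).
Qed.
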